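(* For odd integers $p \geq 3$ let $f_p(x) = \frac{x^p - x}{p} + x^{(p+1)/2} + 1$. Then the sequence $M(f_p(x))$ is strictly decreasing in $p$, i.e. $M(f_{p+2}(x)) < M(f_p(x))$ for every odd integer $p \geq 3$.
   Context: For a polynomial $P(x) = c\prod_{j=1}^d (x - \alpha_j) \in \mathbb{C}[x]$ with $c \neq 0$, its Mahler measure is $M(P(x)) = |c| \prod_{j=1}^d \max\{1, |\alpha_j|\}$. *)

(* Defs.v *)
From mathcomp Require Import all_boot all_order all_algebra.
From mathcomp Require Import complex reals.
Set Implicit Arguments. Unset Strict Implicit. Unset Printing Implicit Defensive.
Import Order.TTheory GRing.Theory Num.Theory.
Local Open Scope ring_scope.
Local Open Scope complex_scope.

Definition complex_roots (R : realType) (P : {poly R[i]}) : seq R[i] :=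
  sval (closed_field_poly_normal P).

(* The roots are listed with multiplicity; [mahler_prodE] shows that the value
   does not depend on the factorization picked. By convention mahler 0 = 0. *)
Definition mahler (R : realType) (P : {poly R[i]}) : R :=
  Normc.normc (lead_coef P) *
  \prod_(z <- complex_roots P) Num.max 1 (Normc.normc z).

Lemma mahler_prodE (R : realType) (c : R[i]) (s : seq R[i]) : c != 0 ->
  mahler (c *: \prod_(z <- s) ('X - z%:P)) =
  Normc.normc c * \prod_(z <- s) Num.max 1 (Normc.normc z).
Proof.
move=> c0; rewrite /mahler /complex_roots.
case: closed_field_poly_normal => r /=.
have lcE : lead_coef (c *: \prod_(z <- s) ('X - z%:P)) = c.
  by rewrite lead_coefZ (monicP (monic_prod_XsubC _ _ _)) mulr1.
by rewrite lcE => /(scalerI c0)/prod_XsubC_eq sr; rewrite (perm_big _ sr).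
Qed.

Definition fpoly (R : realType) (p : nat) : {poly R[i]} :=
  p%:R^-1 *: ('X^p - 'X) + 'X^((p + 1) %/ 2) + 1.

(* Main.v *)
(* Write p = 2k + 1 and f_p = g + 1, where g = x^(k+1) (1 + (x^k - x^-k) / p).
   As g(u x) = u g(x) when u^k = 1, the product of the f_p(u x) over the k-th
   roots of unity u is 1 - (-g)^k. On the circle |x|^k = t with 1 < t < p - 1,
   one has |g|^k >= t (t - (t^2 - 1) / p)^k > 1; when this bound is 1 + 1 / e,
   comparing Mahler measures on that circle shows that M(f_p)^k and M(g)^k agree
   up to the factor 1 + e, provided that f_p has k + 1 roots in the closed unit
   disk, which is read off from the same comparison at two radii. Hence M(f_p)
   and M(g) = (1 + sqrt (1 + 4 / p^2)) / 2 agree up to the factor 1 + e / k. At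
   t = p / 2 and for p >= 9, this error is negligible against the decrease of
   M(g), of order 4 / p^3. For p = 3, 5, 7, M(f_(p+2)) is bounded from above in
   the same way, and M(f_p) from below by a real root for p = 3 and by an
   approximate factorization for p = 5, 7. *)
Require Import Defs.
From mathcomp Require Import all_boot all_order all_algebra.
From mathcomp Require Import complex polyrcf reals.
From mathcomp Require Import ring lra.
Set Implicit Arguments.
Unset Strict Implicit.
Unset Printing Implicit Defensive.
Import Order.TTheory GRing.Theory Num.Theory.
Local Open Scope ring_scope.
Local Open Scope complex_scope.

Local Notation normc := Normc.normc.

Lemma bernoulli (R : realDomainType) (x : R) (n : nat) :
  0 <= x -> 1 + x *+ n <= (1 + x) ^+ n.
Proof.
move=> x_ge0; elim: n => [|n IHn]; first by rewrite mulr0n addr0.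
rewrite exprS; apply: le_trans (ler_wpM2l (addr_ge0 ler01 x_ge0) IHn).
rewrite mulrDl mul1r mulrDr mulr1 mulrSr addrA lerD2l lerDl.
by rewrite mulr_ge0 ?mulrn_wge0.
Qed.

Lemma ler_bernoulli (R : realFieldType) (n : nat) (x y d : R) : (0 < n)%N ->
  0 <= x -> 0 <= y -> 0 <= d -> x ^+ n <= (1 + d) * y ^+ n ->
  x <= y * (1 + d / n%:R).
Proof.
move=> n_gt0 x_ge0 y_ge0 d_ge0 xy.
have dn_ge0 : 0 <= d / n%:R by rewrite divr_ge0.
rewrite -(ler_pXn2r n_gt0) ?nnegrE ?mulr_ge0 ?addr_ge0 //.
apply: le_trans xy _; rewrite exprMn mulrC ler_wpM2l ?exprn_ge0 //.
apply: le_trans (bernoulli n dn_ge0).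
by rewrite -[_ *+ n]mulr_natr divfK // pnatr_eq0 -lt0n.
Qed.

Lemma ler_subrX (R : realFieldType) (n : nat) (x y : R) : (0 < n)%N ->
  0 <= x -> x <= y -> 0 < y -> (1 - x / y) * y ^+ n <= y ^+ n - x ^+ n.
Proof.
move=> n_gt0 x_ge0 xy y_gt0; rewrite mulrBl mul1r lerD2l lerN2.
have xy_ge0 : 0 <= x / y by rewrite divr_ge0 ?(ltW y_gt0).
rewrite -ler_pdivrMr ?exprn_gt0 // -expr_div_n -[leRHS]expr1.
by rewrite ler_wiXn2l // ler_pdivrMr ?mul1r.
Qed.

Lemma leq_of_expr_le (R : realDomainType) (x d : R) (m n : nat) :
  1 <= x -> d < x -> x ^+ m <= d * x ^+ n -> (m <= n)%N.
Proof.
move=> x_ge1 dx; have x_gt0 : 0 < x by exact: lt_le_trans x_ge1.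
apply: contraTT; rewrite -ltnNge -ltNge => nm.
apply: lt_le_trans (ler_weXn2l x_ge1 nm).
by rewrite exprS ltr_pM2r ?exprn_gt0.
Qed.

Lemma ler_of_expr_le (R : archiRealFieldType) (c d x y : R) :
  0 < c -> 0 <= y -> (forall n, (0 < n)%N -> c * x ^+ n <= d * y ^+ n) ->
  x <= y.
Proof.
move=> c_gt0 y_ge0 xy; rewrite leNgt; apply/negP => yx.
have [y_eq0|y_neq0] := eqVneq y 0.
  by have := xy 1%N isT; rewrite y_eq0 mulr0 leNgt mulr_gt0 // -y_eq0.
have y_gt0 : 0 < y by rewrite lt_def y_neq0.
pose h := x / y - 1; have h_gt0 : 0 < h by rewrite subr_gt0 ltr_pdivlMr ?mul1r.
have bounded n : (0 < n)%N -> 1 + h *+ n <= d / c.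
  move=> n_gt0; apply: le_trans (bernoulli n (ltW h_gt0)) _.
  rewrite addrC subrK expr_div_n ler_pdivlMr // mulrAC.
  by rewrite ler_pdivrMr ?exprn_gt0 // mulrC xy.
pose n := (Num.bound `|d / c / h|).+1.
have : d / c < h *+ n.
  rewrite -mulr_natl -ltr_pdivrMr //; apply: le_lt_trans (ler_norm _) _.
  by apply: lt_trans (archi_boundP (normr_ge0 _)) _; rewrite ltr_nat.
by have := bounded n isT; lra.
Qed.

Lemma exists_root_gt1 (R : rcfType) (n : nat) (y : R) : (0 < n)%N -> 1 < y ->
  exists2 x : R, 1 < x & x ^+ n = y.
Proof.
move=> n_gt0 y_gt1; have [x x_gt0] := nth_root n.-1 (lt_trans ltr01 y_gt1).
rewrite prednK // => xn; exists x => //.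
by rewrite -(ltr_pXn2r n_gt0) ?nnegrE ?ler01 ?(ltW x_gt0) // expr1n xn.
Qed.

Lemma prodr_const_seq (R : pzSemiRingType) (I : Type) (s : seq I) (x : R) :
  \prod_(i <- s) x = x ^+ size s.
Proof. by rewrite big_const_seq count_predT iter_mulr_1. Qed.

Section ComplexModulus.
Variable R : rcfType.
Implicit Types x y z : R[i].

Lemma normc_ge0 z : 0 <= normc z.
Proof. by case: z => a b; exact: sqrtr_ge0. Qed.

Lemma normc_gt0 z : (0 < normc z) = (z != 0).
Proof.
rewrite lt_def normc_ge0 andbT; congr (~~ _); apply/eqP/eqP => [|->].
  exact: Normc.eq0_normc.
exact: Normc.normc0.
Qed.

Lemma normcX z n : normc (z ^+ n) = normc z ^+ n.
Proof.
elim: n => [|n IHn]; first by rewrite !expr0 Normc.normc1.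
by rewrite !exprS Normc.normcM IHn.
Qed.

Lemma normc_prod (I : Type) (s : seq I) (F : I -> R[i]) :
  normc (\prod_(i <- s) F i) = \prod_(i <- s) normc (F i).
Proof. exact: (big_morph _ (@Normc.normcM R) (@Normc.normc1 R)). Qed.

Lemma normc_real (a : R) : normc a%:C = `|a|.
Proof. by rewrite /Normc.normc /= expr0n addr0 sqrtr_sqr. Qed.

Lemma lerB_normcD x y : normc x - normc y <= normc (x + y).
Proof.
by rewrite lerBlDr -(normcN y) -[X in normc X](addrK y); exact: le_normcD.
Qed.

Lemma lerB_normcB x y : normc x - normc y <= normc (x - y).
Proof. by rewrite -(normcN y) lerB_normcD. Qed.

Lemma sqr_normcE z : normc z ^+ 2 = complex.Re z ^+ 2 + complex.Im z ^+ 2.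
Proof. by case: z => a b /=; rewrite sqr_sqrtr // addr_ge0 ?sqr_ge0. Qed.

Lemma normc_conj z : normc z^* = normc z.
Proof. by case: z => a b /=; rewrite sqrrN. Qed.

Lemma ler_norm_Re z : `|complex.Re z| <= normc z.
Proof.
rewrite -ler_sqr ?nnegrE ?normc_ge0 // real_normK ?num_real //.
by rewrite sqr_normcE lerDl sqr_ge0.
Qed.

Lemma ler_normc_horner_Poly (s : seq R[i]) x :
  normc (Poly s).[x] <= (Poly [seq normc a | a <- s]).[normc x].
Proof.
rewrite !horner_Poly; elim: s => [|a s IHs].
  by rewrite [leLHS]Normc.normc0.
rewrite /=; apply: le_trans (le_normcD _ _) _.
by rewrite Normc.normcM lerD2r ler_wpM2r ?normc_ge0.
Qed.

End ComplexModulus.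

Section MahlerMeasure.
Variable R : realType.
Implicit Types (rho r s t a d : R) (b u x z : R[i]) (P : {poly R[i]}).

Lemma complex_rootsE P :
  P = lead_coef P *: \prod_(z <- complex_roots P) ('X - z%:P).
Proof. by rewrite /complex_roots; case: closed_field_poly_normal. Qed.

Lemma mem_complex_roots P z : P != 0 -> (z \in complex_roots P) = root P z.
Proof.
move=> P_neq0; rewrite [in RHS](complex_rootsE P) rootZ ?lead_coef_eq0 //.
by rewrite root_prod_XsubC.
Qed.

Lemma horner_complex_roots P x :
  P.[x] = lead_coef P * \prod_(z <- complex_roots P) (x - z).
Proof.
rewrite [in LHS](complex_rootsE P) hornerZ horner_prod.
by congr (_ * _); apply: eq_bigr => z _; rewrite hornerXsubC.
Qed.

Lemma size_complex_roots P :
  P != 0 -> size (complex_roots P) = (size P).-1.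
Proof.
move=> P_neq0; rewrite [in RHS](complex_rootsE P) size_scale ?lead_coef_eq0 //.
by rewrite size_prod_XsubC.
Qed.

(* The Mahler measure for the circle of radius rho: its logarithm is the mean of
   [log |P|] over that circle, and [mahler P] is [mahler_at 1 P]. *)
Definition mahler_at rho P : R :=
  normc (lead_coef P) * \prod_(z <- complex_roots P) Num.max rho (normc z).

Lemma mahler_at_ge0 rho P : 0 <= mahler_at rho P.
Proof.
rewrite mulr_ge0 ?normc_ge0 // prodr_ge0 // => z _.
by rewrite le_max normc_ge0 orbT.
Qed.

Lemma mahler_ge0 P : 0 <= mahler P.
Proof. exact: (mahler_at_ge0 1). Qed.

Lemma mahler_at0 rho : mahler_at rho 0 = 0.
Proof. by rewrite /mahler_at lead_coef0 Normc.normc0 mul0r. Qed.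

Lemma mahler_at_prod_XsubC rho b (zs : seq R[i]) :
  mahler_at rho (b *: \prod_(z <- zs) ('X - z%:P)) =
  normc b * \prod_(z <- zs) Num.max rho (normc z).
Proof.
have [->|b_neq0] := eqVneq b 0.
  by rewrite scale0r mahler_at0 Normc.normc0 mul0r.
set P := _ *: _; have lead_P : lead_coef P = b.
  by rewrite lead_coefZ (monicP (monic_prod_XsubC _ _ _)) mulr1.
have := complex_rootsE P.
rewrite lead_P => /(scalerI b_neq0)/prod_XsubC_eq eq_zs.
by rewrite /mahler_at lead_P (perm_big _ eq_zs).
Qed.

Lemma mahler_at1 rho : mahler_at rho 1 = 1.
Proof.
have := mahler_at_prod_XsubC rho 1 [::].
by rewrite !big_nil scale1r Normc.normc1 mulr1.
Qed.

Lemma mahler_atM rho : {morph mahler_at rho : P Q / P * Q}.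
Proof.
move=> P Q; rewrite {1}(complex_rootsE P) {1}(complex_rootsE Q).
rewrite -scalerAl -scalerAr scalerA -big_cat mahler_at_prod_XsubC.
by rewrite big_cat Normc.normcM /mahler_at mulrACA.
Qed.

Lemma mahler_at_prod rho (I : Type) (s : seq I) (F : I -> {poly R[i]}) :
  mahler_at rho (\prod_(i <- s) F i) = \prod_(i <- s) mahler_at rho (F i).
Proof. exact: (big_morph _ (mahler_atM rho) (mahler_at1 rho)). Qed.

Lemma mahler_atXn rho P n : mahler_at rho (P ^+ n) = mahler_at rho P ^+ n.
Proof.
elim: n => [|n IHn]; first by rewrite !expr0 mahler_at1.
by rewrite !exprS mahler_atM IHn.
Qed.

Lemma mahler_atZ rho b P :
  mahler_at rho (b *: P) = normc b * mahler_at rho P.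
Proof.
rewrite [in LHS](complex_rootsE P) scalerA mahler_at_prod_XsubC.
by rewrite Normc.normcM mulrA.
Qed.

Lemma mahler_at_rotation rho u P : normc u = 1 ->
  mahler_at rho (P \Po (u *: 'X)) = mahler_at rho P.
Proof.
move=> u1; have u_neq0 : u != 0 by rewrite -normc_gt0 u1 ltr01.
have rotate_factor z : ('X - z%:P) \Po (u *: 'X) = u *: ('X - (z / u)%:P).
  rewrite comp_polyB comp_polyX comp_polyC scalerBr -[u *: _%:P]mul_polyC.
  by rewrite -polyCM mulrC divfK.
rewrite [in LHS](complex_rootsE P) comp_polyZ mahler_atZ rmorph_prod /=.
rewrite mahler_at_prod; congr (_ * _); apply: eq_bigr => z _.
rewrite rotate_factor mahler_atZ u1 mul1r.
have := mahler_at_prod_XsubC rho 1 [:: z / u].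
rewrite !big_seq1 scale1r Normc.normc1 mul1r => ->.
by rewrite Normc.normcM Normc.normcV u1 invr1 mulr1.
Qed.

Lemma normc_horner0_le_mahler_at rho P : normc P.[0] <= mahler_at rho P.
Proof.
rewrite horner_complex_roots Normc.normcM normc_prod.
apply: ler_wpM2l; first exact: normc_ge0.
by apply: ler_prod => z _; rewrite normc_ge0 sub0r normcN le_max lexx orbT.
Qed.

Lemma lead_coef_le_mahler_at rho P : P != 0 -> 0 <= rho ->
  normc (lead_coef P) * rho ^+ (size P).-1 <= mahler_at rho P.
Proof.
move=> P_neq0 rho_ge0; rewrite ler_wpM2l ?normc_ge0 //.
rewrite -size_complex_roots // -prodr_const_seq.
by apply: ler_prod => z _; rewrite rho_ge0 le_max lexx.
Qed.

Lemma root_le_mahler P z : P != 0 -> root P z ->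
  normc (lead_coef P) * normc z <= mahler P.
Proof.
move=> P_neq0; rewrite -mem_complex_roots // => Pz.
rewrite ler_wpM2l ?normc_ge0 // (perm_big _ (perm_to_rem Pz)) big_cons.
have z_le : normc z <= Num.max 1 (normc z) by rewrite le_max lexx orbT.
apply: le_trans z_le _; rewrite ler_peMr ?le_max ?ler01 //.
elim/big_ind: _ => // [x y|y _]; first exact: mulr_ege1.
by rewrite le_max lexx.
Qed.

Definition disk_roots r P : nat :=
  count (fun z => normc z <= r) (complex_roots P).

Lemma mahler_at_annulus r rho P : 0 < r -> r <= rho ->
  (forall z, root P z -> r < normc z -> rho <= normc z) ->
  mahler_at rho P = mahler_at r P * (rho / r) ^+ disk_roots r P.
Proof.
move=> r_gt0 r_rho annulus; have [->|P_neq0] := eqVneq P 0.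
  by rewrite !mahler_at0 mul0r.
have {annulus} : {in complex_roots P, forall z, r < normc z -> rho <= normc z}.
  by move=> z; rewrite mem_complex_roots //; exact: annulus.
rewrite /mahler_at -mulrA => annulus; congr (_ * _); rewrite /disk_roots.
elim: (complex_roots P) annulus => [|z s IHs] annulus.
  by rewrite !big_nil mul1r.
rewrite !big_cons {}IHs => [|y sy]; last by apply: annulus; rewrite inE sy orbT.
rewrite [count _ _]/= exprD mulrACA; congr (_ * _).
have [zr|rz] := leP (normc z) r.
  by rewrite max_l ?(le_trans zr) // expr1 mulrC divfK ?gt_eqF.
by rewrite max_r ?expr0 ?mulr1 // annulus ?mem_head.
Qed.

(* A form of Rouché's theorem: the growth of the Mahler measure between
   the radii s and t counts the roots. *)
Lemma disk_roots_eq r s t a d P (k n : nat) :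
  0 < r -> r <= s -> s <= t -> 0 < a -> 0 < d ->
  d ^+ 2 * s ^+ k < t ^+ k ->
  (forall z, root P z -> r < normc z -> t <= normc z) ->
  {in [:: s; t], forall rho,
     mahler_at rho P ^+ k <= d * (a * rho ^+ n) ^+ k /\
     (a * rho ^+ n) ^+ k <= d * mahler_at rho P ^+ k} ->
  disk_roots r P = n.
Proof.
move=> r_gt0 rs st a_gt0 d_gt0 dst annulus growth.
have s_gt0 : 0 < s by exact: lt_le_trans rs.
pose tau := (t / s) ^+ k.
have tau_ge1 : 1 <= tau by rewrite exprn_ege1 // ler_pdivlMr ?mul1r.
have d_tau : d ^+ 2 < tau by rewrite /tau expr_div_n ltr_pdivlMr ?exprn_gt0.
have ratioP : mahler_at t P ^+ k = mahler_at s P ^+ k * tau ^+ disk_roots r P.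
  rewrite (mahler_at_annulus r_gt0 (le_trans rs st) annulus).
  rewrite (@mahler_at_annulus r s P) // => [|z Pz rz]; last first.
    exact: le_trans st (annulus z Pz rz).
  have -> : t / r = s / r * (t / s) by rewrite [RHS]mulrC mulrA divfK ?gt_eqF.
  rewrite [(s / r * _) ^+ _]exprMn mulrA exprMn /tau.
  by rewrite -!exprM [(k * _)%N]mulnC.
have ratio_n : (a * t ^+ n) ^+ k = (a * s ^+ n) ^+ k * tau ^+ n.
  rewrite /tau -exprM mulnC exprM -exprMn -mulrA -exprMn.
  by rewrite [s * _]mulrC divfK ?gt_eqF.
have [sP Ps] := growth s (mem_head _ _).
have [] := growth t (mem_last s [:: t]); rewrite ratioP ratio_n => tP Pt.
move: sP Ps tP Pt; set X := mahler_at s P ^+ k; set Y := (a * s ^+ n) ^+ k.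
move=> sP Ps tP Pt.
have Y_gt0 : 0 < Y by rewrite exprn_gt0 ?mulr_gt0 ?exprn_gt0.
have X_gt0 : 0 < X by rewrite -(pmulr_rgt0 _ d_gt0) (lt_le_trans Y_gt0).
have tau_gt0 m : 0 < tau ^+ m by rewrite exprn_gt0 ?(lt_le_trans ltr01).
apply/eqP; rewrite eqn_leq !(leq_of_expr_le tau_ge1 d_tau) //.
- rewrite -(ler_pM2l Y_gt0); apply: le_trans Pt _.
  by rewrite [leRHS]mulrCA expr2 -mulrA ler_pM2l // mulrA ler_pM2r.
- rewrite -(ler_pM2l X_gt0); apply: le_trans tP _.
  by rewrite [leRHS]mulrCA expr2 -mulrA ler_pM2l // mulrA ler_pM2r.
Qed.

End MahlerMeasure.

Section CircleComparison.
Variable R : realType.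
Implicit Types (rho c e : R) (u x y z : R[i]) (P Q g : {poly R[i]}) (n k : nat).

Definition unity_roots n : seq R[i] := complex_roots ('X^n - 1).

Lemma unity_rootsE n : (0 < n)%N ->
  'X^n - 1 = \prod_(u <- unity_roots n) ('X - u%:P).
Proof.
move=> n_gt0; rewrite [LHS]complex_rootsE (monicP _) ?scale1r //.
by rewrite -polyC1 monicXnsubC.
Qed.

Lemma size_unity_roots n : (0 < n)%N -> size (unity_roots n) = n.
Proof.
move=> n_gt0; have := @size_XnsubC R[i] n 1 n_gt0.
by rewrite polyC1 unity_rootsE // size_prod_XsubC => -[].
Qed.

Lemma expr_unity_roots n u : (0 < n)%N -> u \in unity_roots n -> u ^+ n = 1.
Proof.
move=> n_gt0; rewrite -root_prod_XsubC -unity_rootsE //.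
by move=> un; exact/unity_rootP.
Qed.

Lemma normc_unity_roots n u : (0 < n)%N -> u \in unity_roots n -> normc u = 1.
Proof.
move=> n_gt0 /(expr_unity_roots n_gt0) /(congr1 (@Normc.normc R)) /eqP.
by rewrite normcX Normc.normc1 pexpr_eq1 ?normc_ge0 // => /eqP.
Qed.

Lemma prod_subM_unity_roots n x y : (0 < n)%N ->
  \prod_(u <- unity_roots n) (x - u * y) = x ^+ n - y ^+ n.
Proof.
move=> n_gt0; have [->|y_neq0] := eqVneq y 0.
  under eq_bigr do rewrite mulr0 subr0.
  by rewrite prodr_const_seq size_unity_roots // expr0n gtn_eqF // subr0.
transitivity (\prod_(u <- unity_roots n) (y * (x / y - u))).
  apply: eq_bigr => u _.
  by rewrite mulrBr [y * (x / y)]mulrC divfK // [y * u]mulrC.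
rewrite big_split /= prodr_const_seq size_unity_roots //.
have -> : \prod_(u <- unity_roots n) (x / y - u) = ('X^n - 1).[x / y].
  rewrite unity_rootsE // horner_prod.
  by apply: eq_bigr => u _; rewrite hornerXsubC.
by rewrite !hornerE mulrBr mulr1 -exprMn [y * _]mulrC divfK.
Qed.

(* Together, [prod_circle_le] and [prod_circle_ge] are a discrete Jensen
   formula: the mean of [log |P|] over n equidistributed points of the circle of
   radius rho tends to [log (mahler_at rho P)] as n grows. *)
Lemma prod_circleE n rho P : (0 < n)%N ->
  \prod_(u <- unity_roots n) normc P.[u * rho%:C] =
  normc (lead_coef P) ^+ n *
  \prod_(z <- complex_roots P) normc (z ^+ n - rho%:C ^+ n).
Proof.
move=> n_gt0.
under eq_bigr do rewrite horner_complex_roots Normc.normcM normc_prod.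
rewrite big_split /= prodr_const_seq size_unity_roots // exchange_big /=.
congr (_ * _); apply: eq_bigr => z _.
rewrite -prod_subM_unity_roots // normc_prod.
by apply: eq_bigr => u _; rewrite -normcN opprB.
Qed.

Lemma prod_circle_le n rho P : (0 < n)%N -> 0 <= rho ->
  \prod_(u <- unity_roots n) normc P.[u * rho%:C] <=
  2 ^+ size (complex_roots P) * mahler_at rho P ^+ n.
Proof.
move=> n_gt0 rho_ge0; rewrite prod_circleE // exprMn mulrCA.
rewrite ler_wpM2l ?exprn_ge0 ?normc_ge0 //.
rewrite -prodr_const_seq -prodrXl -big_split /=; apply: ler_prod => z _.
rewrite normc_ge0 (le_trans (le_normcD _ _)) //= normcN !normcX normc_real.
by rewrite ger0_norm // mulr_natl mulr2n lerD // lerXn2r ?nnegrE ?le_max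
     ?normc_ge0 ?rho_ge0 ?lexx ?orbT.
Qed.

Definition circle_gap rho z : R :=
  1 - Num.min rho (normc z) / Num.max rho (normc z).

Lemma circle_gap_ge0 rho z : 0 < rho -> 0 <= circle_gap rho z.
Proof.
move=> rho_gt0; rewrite subr_ge0 ler_pdivrMr ?lt_max ?rho_gt0 //.
by rewrite mul1r ge_min le_max lexx.
Qed.

Lemma circle_gap_gt0 rho z :
  0 < rho -> normc z != rho -> 0 < circle_gap rho z.
Proof.
move=> rho_gt0 z_rho; rewrite subr_gt0 ltr_pdivrMr ?lt_max ?rho_gt0 // mul1r.
by move: z_rho; case: (ltgtP rho (normc z)).
Qed.

Lemma ler_normc_subrX n rho z : (0 < n)%N -> 0 < rho ->
  circle_gap rho z * Num.max rho (normc z) ^+ n <=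
  normc (z ^+ n - rho%:C ^+ n).
Proof.
move=> n_gt0 rho_gt0; rewrite /circle_gap.
have rhoE : normc rho%:C = rho by rewrite normc_real gtr0_norm.
have [rho_z|z_rho] := leP rho (normc z).
  apply: le_trans (lerB_normcB _ _); rewrite !normcX rhoE.
  by apply: ler_subrX => //; rewrite ?ltW ?(lt_le_trans rho_gt0).
rewrite -[leRHS]normcN opprB; apply: le_trans (lerB_normcB _ _).
rewrite !normcX rhoE.
by apply: ler_subrX => //; rewrite ?normc_ge0 ?ltW.
Qed.

Lemma prod_circle_ge rho P : 0 < rho ->
  (forall x, normc x = rho -> P.[x] != 0) ->
  exists2 c : R, 0 < c & forall n, (0 < n)%N ->
  c * mahler_at rho P ^+ n <= \prod_(u <- unity_roots n) normc P.[u * rho%:C].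
Proof.
move=> rho_gt0 P_rho.
have P_neq0 : P != 0.
  apply/eqP => P0; have := P_rho rho%:C.
  by rewrite normc_real gtr0_norm // P0 horner0 eqxx => /(_ erefl).
exists (\prod_(z <- complex_roots P) circle_gap rho z).
  rewrite big_seq; apply: prodr_gt0 => z; rewrite mem_complex_roots // => Pz.
  by apply: circle_gap_gt0 => //; apply: contraTN Pz => /eqP/P_rho.
move=> n n_gt0; rewrite prod_circleE // exprMn mulrCA.
rewrite ler_wpM2l ?exprn_ge0 ?normc_ge0 //.
rewrite -prodrXl -big_split /=; apply: ler_prod => z _.
by rewrite ler_normc_subrX // mulr_ge0 ?circle_gap_ge0 ?exprn_ge0 // le_max ltW.
Qed.

Lemma ler_mahler_at rho c P Q : 0 < rho -> 0 <= c ->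
  (forall x, normc x = rho -> P.[x] != 0) ->
  (forall x, normc x = rho -> normc P.[x] <= c * normc Q.[x]) ->
  mahler_at rho P <= c * mahler_at rho Q.
Proof.
move=> rho_gt0 c_ge0 P_rho PQ.
have [a a_gt0 leP] := prod_circle_ge rho_gt0 P_rho.
apply: (ler_of_expr_le (d := 2 ^+ size (complex_roots Q)) a_gt0) => [|n n_gt0].
  by rewrite mulr_ge0 ?mahler_at_ge0.
apply: le_trans (leP n n_gt0) _; rewrite exprMn mulrCA.
have leQ := prod_circle_le Q n_gt0 (ltW rho_gt0).
apply: le_trans (ler_wpM2l (exprn_ge0 n c_ge0) leQ).
rewrite -[in X in c ^+ X](size_unity_roots n_gt0) -prodr_const_seq.
rewrite -big_split /=.
rewrite big_seq [leRHS]big_seq; apply: ler_prod => u un.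
rewrite normc_ge0 PQ // Normc.normcM (normc_unity_roots n_gt0 un) mul1r.
by rewrite normc_real gtr0_norm.
Qed.

Definition prod_rotations k P : {poly R[i]} :=
  \prod_(u <- unity_roots k) (P \Po (u *: 'X)).

Lemma mahler_at_prod_rotations rho k P : (0 < k)%N ->
  mahler_at rho (prod_rotations k P) = mahler_at rho P ^+ k.
Proof.
move=> k_gt0.
rewrite mahler_at_prod -[in RHS](size_unity_roots k_gt0) -prodr_const_seq.
rewrite big_seq [RHS]big_seq; apply: eq_bigr => u uk.
by rewrite mahler_at_rotation ?(normc_unity_roots k_gt0).
Qed.

Lemma horner_prod_rotations_add1 k g x : (0 < k)%N ->
  (forall u x, u ^+ k = 1 -> g.[u * x] = u * g.[x]) ->
  (prod_rotations k (g + 1)).[x] = 1 - (- g.[x]) ^+ k.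
Proof.
move=> k_gt0 g_twist; rewrite -[1 in RHS](expr1n _ k).
rewrite -prod_subM_unity_roots // horner_prod big_seq [RHS]big_seq.
apply: eq_bigr => u uk; rewrite horner_comp !hornerE.
by rewrite g_twist ?(expr_unity_roots k_gt0 uk) // mulrN opprK addrC.
Qed.

(* The product of the rotations of [g + 1] is close to a power of [g], up to
   sign, wherever [g] is large. *)
Lemma mahler_at_add1_expn rho e g k :
  (0 < k)%N -> 0 < rho -> 0 < e ->
  (forall u x, u ^+ k = 1 -> g.[u * x] = u * g.[x]) ->
  (forall x, normc x = rho -> 1 + e^-1 <= normc g.[x] ^+ k) ->
  mahler_at rho (g + 1) ^+ k <= (1 + e) * mahler_at rho g ^+ k /\
  mahler_at rho g ^+ k <= (1 + e) * mahler_at rho (g + 1) ^+ k.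
Proof.
move=> k_gt0 rho_gt0 e_gt0 g_twist g_large; pose G := prod_rotations k (g + 1).
have G_x x : G.[x] = 1 - (- g.[x]) ^+ k by exact: horner_prod_rotations_add1.
have eV_gt0 : 0 < e^-1 by rewrite invr_gt0.
have G_ge x : normc g.[x] ^+ k - 1 <= normc G.[x].
  rewrite G_x -[leRHS]normcN opprB; apply: le_trans (lerB_normcB _ _).
  by rewrite Normc.normc1 normcX normcN.
have G_large x : normc x = rho -> e^-1 <= normc G.[x].
  by move=> xr; have := g_large x xr; have := G_ge x; lra.
have ge1M a : e^-1 <= a -> 1 <= e * a.
  by move=> ea; rewrite mulrC -ler_pdivrMr // mul1r.
rewrite -mahler_at_prod_rotations // -mahler_atXn.
split; apply: ler_mahler_at => //.
- by rewrite addr_ge0 ?ltW.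
- by move=> x /G_large Gx; rewrite -normc_gt0 (lt_le_trans eV_gt0).
- move=> x /g_large gx; rewrite G_x horner_exp normcX.
  apply: le_trans (le_normcD _ _) _; rewrite Normc.normc1 normcN normcX normcN.
  rewrite mulrDl mul1r addrC lerD2l ge1M //; lra.
- by rewrite addr_ge0 ?ltW.
- move=> x /g_large gx; rewrite -normc_gt0 horner_exp normcX.
  by apply: lt_le_trans gx; rewrite addr_gt0.
- move=> x xr; have := ge1M _ (G_large x xr); have := G_ge x.
  by rewrite horner_exp normcX; lra.
Qed.

Lemma mahler_at_XnsubC rho k z : (0 < k)%N -> 0 <= rho ->
  mahler_at rho ('X^k - z%:P) = Num.max (rho ^+ k) (normc z).
Proof.
move=> k_gt0 rho_ge0; set P := _ - _.
have P_monic : P \is monic by exact: monicXnsubC.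
have P_neq0 := monic_neq0 P_monic.
pose w := normc (k.-root z).
have wk : w ^+ k = normc z by rewrite -normcX rootCK.
have w_ge0 : 0 <= w by exact: normc_ge0.
rewrite /mahler_at (monicP P_monic) Normc.normc1 mul1r.
have -> : Num.max (rho ^+ k) (normc z) = Num.max rho w ^+ k.
  rewrite -wk; have [rho_w|w_rho] := leP rho w.
    by rewrite max_r // lerXn2r.
  by rewrite max_l // lerXn2r // ltW.
have sizeP : size (complex_roots P) = k.
  by rewrite size_complex_roots // size_XnsubC.
rewrite -[in RHS]sizeP -prodr_const_seq big_seq [RHS]big_seq.
apply: eq_bigr => y; rewrite mem_complex_roots // rootE !hornerE subr_eq0.
move=> /eqP yk; congr Num.max; apply/eqP; rewrite -(@eqrXn2 _ k) ?normc_ge0 //.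
by rewrite wk -normcX yk.
Qed.

Lemma mahler_at_polyX rho : 0 <= rho -> mahler_at rho 'X = rho.
Proof.
move=> rho_ge0; have := mahler_at_XnsubC 0 (ltn0Sn 0) rho_ge0.
by rewrite subr0 Normc.normc0 !expr1 max_l.
Qed.

End CircleComparison.

Section GPoly.
Variable R : realType.
Implicit Types (p q t rho : R) (u x y z : R[i]) (j k : nat).

(* [fpoly R p - 1] for [p = k.*2.+1], with p and k made independent. *)
Definition gpoly p k : {poly R[i]} :=
  'X * ('X^k + (p^-1)%:C *: ('X^k ^+ 2 - 1)).

Lemma fpolyE k : fpoly R k.*2.+1 = gpoly k.*2.+1%:R k + 1.
Proof.
rewrite /fpoly /gpoly fmorphV rmorph_nat.
have -> : ((k.*2.+1 + 1) %/ 2)%N = k.+1 by rewrite addn1 -doubleS -muln2 mulnK.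
rewrite mulrDr -scalerAr mulrBr mulr1 -!exprS -exprM muln2 -exprS.
by rewrite [_ *: _ + _]addrC.
Qed.

Lemma horner_gpoly p k x :
  (gpoly p k).[x] = x * (x ^+ k + (x ^+ k ^+ 2 - 1) / p%:C).
Proof. by rewrite !hornerE fmorphV [_ / _]mulrC. Qed.

Lemma horner_gpoly_twist p k u x : u ^+ k = 1 ->
  (gpoly p k).[u * x] = u * (gpoly p k).[x].
Proof. by move=> uk; rewrite !horner_gpoly exprMn uk mul1r mulrA. Qed.

Definition circle_lb p t : R := t - (t ^+ 2 - 1) / p.

(* The triangle inequality on [y + (y ^+ 2 - 1) / p] would give [t ^+ 2 + 1]
   instead of [t ^+ 2 - 1], which is useless near [t = 1]; multiplying by the
   conjugate of y and taking real parts loses nothing at [y = - t]. *)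
Lemma normc_addr_sqr_ge p y : 0 < p -> 1 <= normc y ->
  circle_lb p (normc y) <= normc (y + (y ^+ 2 - 1) / p%:C).
Proof.
move=> p_gt0 y_ge1; have y_gt0 : 0 < normc y by exact: lt_le_trans y_ge1.
rewrite -(ler_pM2l y_gt0) -[X in X * normc _]normc_conj -Normc.normcM.
apply: le_trans (le_trans (ler_norm _) (ler_norm_Re _)).
have -> : complex.Re (y^* * (y + (y ^+ 2 - 1) / p%:C)) =
    normc y ^+ 2 + complex.Re y * (normc y ^+ 2 - 1) / p.
  by rewrite -fmorphV sqr_normcE; case: (y) => a b /=; ring.
have -> : normc y * circle_lb p (normc y) =
    normc y ^+ 2 + - normc y * (normc y ^+ 2 - 1) / p.
  by rewrite /circle_lb; ring.
rewrite lerD2l ler_pM2r ?invr_gt0 //; apply: ler_wpM2r.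
  by rewrite subr_ge0 expr_ge1 // ltW.
by rewrite lerNl; apply: le_trans (ler_norm_Re y); rewrite -normrN ler_norm.
Qed.

Lemma normc_gpoly_ge p k x : 0 < p -> 1 <= normc x ->
  normc x * circle_lb p (normc x ^+ k) <= normc (gpoly p k).[x].
Proof.
move=> p_gt0 x_ge1; rewrite horner_gpoly Normc.normcM.
rewrite ler_wpM2l ?normc_ge0 // -normcX normc_addr_sqr_ge //.
by rewrite normcX exprn_ege1.
Qed.

Lemma circle_lb_gt1 p t : 1 < t -> t < p - 1 -> 1 < circle_lb p t.
Proof.
move=> t_gt1 tp; have p_gt0 : 0 < p by lra.
rewrite /circle_lb ltrBrDr -ltrBrDl ltr_pdivrMr //.
by rewrite -subr_gt0; have := mulr_gt0 (_ : 0 < t - 1) (_ : 0 < p - 1 - t); nra.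
Qed.

Lemma gpoly1_root_free_annulus p k rho z : (0 < k)%N -> 0 <= rho ->
  rho ^+ k <= p - 1 ->
  root (gpoly p k + 1) z -> 1 < normc z -> rho <= normc z.
Proof.
move=> k_gt0 rho_ge0 rho_p.
rewrite rootE hornerD hornerC addr_eq0 => /eqP gz z_gt1.
rewrite leNgt; apply/negP => z_rho.
have zk_lt : normc z ^+ k < rho ^+ k by rewrite ltr_pXn2r ?nnegrE ?normc_ge0.
have zk_gt1 : 1 < normc z ^+ k by rewrite exprn_egt1 // -lt0n.
have p_gt0 : 0 < p by lra.
have := normc_gpoly_ge k p_gt0 (ltW z_gt1).
rewrite gz normcN Normc.normc1 leNgt => /negP; apply.
by rewrite mulr_egt1 // circle_lb_gt1 // (lt_le_trans zk_lt).
Qed.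

(* The Mahler measure of [gpoly p k]: [- p * gpoly_mahler p] is the root of
   largest modulus of [Y ^+ 2 + p *: Y - 1], where Y stands for ['X^k]. *)
Definition gpoly_mahler p : R := (1 + Num.sqrt (1 + 4 / p ^+ 2)) / 2.

Lemma gpoly_mahler_quadratic p : gpoly_mahler p ^+ 2 - gpoly_mahler p = p ^- 2.
Proof.
rewrite /gpoly_mahler; set s := Num.sqrt _.
have -> : ((1 + s) / 2) ^+ 2 - (1 + s) / 2 = (s ^+ 2 - 1) / 4 by field.
rewrite sqr_sqrtr; first by rewrite addrC addKr mulrAC divff ?mul1r ?pnatr_eq0.
by rewrite addr_ge0 ?divr_ge0 ?sqr_ge0.
Qed.

Lemma gpoly_mahler_ge1 p : 1 <= gpoly_mahler p.
Proof.
have : 1 <= Num.sqrt (1 + 4 / p ^+ 2).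
  by rewrite -[leLHS]sqrtr1 ler_wsqrtr // lerDl divr_ge0 ?sqr_ge0.
by rewrite /gpoly_mahler; lra.
Qed.

Lemma gpoly_mahler_le p : gpoly_mahler p <= 1 + p ^- 2.
Proof.
by have := gpoly_mahler_quadratic p; have := gpoly_mahler_ge1 p; nra.
Qed.

Lemma gpoly_mahler_ge p : 1 + p ^- 2 - p ^- 4 <= gpoly_mahler p.
Proof.
rewrite -[p ^- 4]exprVn (exprM _ 2 2) exprVn.
have := gpoly_mahler_quadratic p; have := gpoly_mahler_le p.
by have := gpoly_mahler_ge1 p; nra.
Qed.

Lemma gpoly_factor p k (A := gpoly_mahler p) : p != 0 -> gpoly p k =
  (p^-1)%:C *:
    ('X * (('X^k - (- (p * A))%:C%:P) * ('X^k - (p * (A - 1))%:C%:P))).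
Proof.
move=> p_neq0; have := gpoly_mahler_quadratic p; rewrite -/A => A2.
have rootsD : (- (p * A))%:C + (p * (A - 1))%:C = - p%:C.
  by rewrite -rmorphD -rmorphN; congr (_%:C); ring.
have rootsM : (- (p * A))%:C * (p * (A - 1))%:C = -1.
  rewrite -rmorphM -(rmorphN1 (real_complex R)); congr (_%:C).
  transitivity (- p ^+ 2 * (A ^+ 2 - A)); first by ring.
  by rewrite A2 mulNr divff ?expf_neq0.
have quadratic (Y a b : {poly R[i]}) :
    (Y - a) * (Y - b) = Y ^+ 2 + a * b - (a + b) * Y by ring.
rewrite quadratic -polyCD -polyCM rootsD rootsM /gpoly scalerAr; congr (_ * _).
rewrite !polyCN polyC1 mulNr opprK [RHS]scalerDr [RHS]addrC.
by rewrite mul_polyC scalerA -rmorphM mulVf // rmorph1 scale1r.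
Qed.

Lemma mahler_at_gpoly p k rho : (0 < k)%N -> 1 <= rho -> rho ^+ k <= p ->
  mahler_at rho (gpoly p k) = gpoly_mahler p * rho ^+ k.+1.
Proof.
move=> k_gt0 rho_ge1 rho_p; have rho_ge0 : 0 <= rho by exact: le_trans rho_ge1.
have rhok_ge1 : 1 <= rho ^+ k by exact: exprn_ege1.
have p_ge1 : 1 <= p by exact: le_trans rho_p.
have p_gt0 : 0 < p by exact: lt_le_trans p_ge1.
have A_ge1 := gpoly_mahler_ge1 p.
have pA_ge0 : 0 <= p * gpoly_mahler p by rewrite mulr_ge0 ?(le_trans ler01).
have pB_ge0 : 0 <= p * (gpoly_mahler p - 1).
  by rewrite mulr_ge0 ?subr_ge0 ?(le_trans ler01).
have inner_small : p * (gpoly_mahler p - 1) <= 1.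
  have := gpoly_mahler_le p; rewrite -lerBlDl => Ap.
  apply: le_trans (ler_wpM2l (ltW p_gt0) Ap) _.
  by rewrite expr2 invfM mulrA divff ?gt_eqF // mul1r invf_le1.
rewrite gpoly_factor ?gt_eqF // mahler_atZ !mahler_atM !mahler_at_XnsubC //.
rewrite mahler_at_polyX // !normc_real normrN.
rewrite !ger0_norm // ?invr_ge0 ?(ltW p_gt0) //.
rewrite max_r; last by rewrite (le_trans rho_p) // ler_peMr // ltW.
rewrite max_l; last exact: le_trans rhok_ge1.
by rewrite exprS; field; rewrite gt_eqF.
Qed.

Definition gpoly_growth p k t : R := t * circle_lb p t ^+ k.

Lemma normc_gpoly_expn_ge p k x : 0 < p -> 1 <= normc x ->
  0 <= circle_lb p (normc x ^+ k) ->
  gpoly_growth p k (normc x ^+ k) <= normc (gpoly p k).[x] ^+ k.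
Proof.
move=> p_gt0 x_ge1 lb_ge0; rewrite /gpoly_growth -exprMn.
by rewrite lerXn2r ?nnegrE ?mulr_ge0 ?normc_ge0 // normc_gpoly_ge.
Qed.

Lemma ler_gpoly_growth q p t j k :
  1 < t -> t < q - 1 -> q <= p -> (j <= k)%N ->
  gpoly_growth q j t <= gpoly_growth p k t.
Proof.
move=> t_gt1 tq qp jk; have t_gt0 : 0 < t by exact: lt_trans t_gt1.
have q_gt0 : 0 < q by lra.
have lb_q := circle_lb_gt1 t_gt1 tq.
have lb_qp : circle_lb q t <= circle_lb p t.
  rewrite lerD2l lerN2; apply: ler_wpM2l.
    by rewrite subr_ge0 expr_ge1 ?(ltW t_gt1) // ltW.
  by rewrite lef_pV2 // posrE (lt_le_trans q_gt0).
rewrite ler_pM2l //; apply: le_trans (_ : circle_lb q t ^+ k <= _).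
  by rewrite ler_weXn2l // ltW.
by rewrite lerXn2r ?nnegrE // ?(le_trans _ lb_qp) // ltW ?(lt_trans ltr01).
Qed.

End GPoly.

Section GPolyMahler.
Variable R : realType.
Implicit Types (p t rho e d : R) (x z : R[i]) (P S T : {poly R[i]}) (k : nat).

Lemma mahler_at_gpoly1_bounds p k rho e : (0 < k)%N -> 1 < rho ->
  rho ^+ k < p - 1 -> 0 < e -> 1 + e^-1 <= gpoly_growth p k (rho ^+ k) ->
  mahler_at rho (gpoly p k + 1) ^+ k <=
    (1 + e) * (gpoly_mahler p * rho ^+ k.+1) ^+ k /\
  (gpoly_mahler p * rho ^+ k.+1) ^+ k <=
    (1 + e) * mahler_at rho (gpoly p k + 1) ^+ k.
Proof.
move=> k_gt0 rho_gt1 rho_p e_gt0 e_le.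
have rhok_gt1 : 1 < rho ^+ k by rewrite exprn_egt1 // -lt0n.
have p_gt0 : 0 < p by lra.
rewrite -(mahler_at_gpoly k_gt0 (ltW rho_gt1)); last by lra.
apply: mahler_at_add1_expn => // [|u x uk|x x_rho].
- exact: lt_trans rho_gt1.
- exact: horner_gpoly_twist.
- apply: le_trans e_le _; rewrite -x_rho normc_gpoly_expn_ge ?x_rho ?ltW //.
  by rewrite (lt_trans ltr01) // circle_lb_gt1.
Qed.

(* The radii s and t satisfy s^k = 2 and t^k = 11 / 3: in the extreme case
   p = 5, k = 2, [gpoly_growth] is 1 + 73 / 25 at 2 and larger at 11 / 3, and
   (1 + 25 / 73)^2 * 2 is less than 11 / 3. *)
Lemma disk_roots_gpoly1 p k : (1 < k)%N -> 5 <= p ->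
  disk_roots 1 (gpoly p k + 1) = k.+1.
Proof.
move=> k_gt1 p_ge5; have k_gt0 := ltnW k_gt1.
have [s s_gt1 sk] := exists_root_gt1 k_gt0 (ltr1n R 2).
have [t t_gt1 tk] : exists2 t : R, 1 < t & t ^+ k = 11 / 3.
  by apply: exists_root_gt1 => //; lra.
have s_ge0 : 0 <= s by exact: ltW (lt_trans ltr01 s_gt1).
have t_ge0 : 0 <= t by exact: ltW (lt_trans ltr01 t_gt1).
have bounds rho : 1 < rho -> rho ^+ k < 5 - 1 ->
    1 + (25 / 73)^-1 <= gpoly_growth 5 2 (rho ^+ k) ->
    mahler_at rho (gpoly p k + 1) ^+ k <=
      (1 + 25 / 73) * (gpoly_mahler p * rho ^+ k.+1) ^+ k /\
    (gpoly_mahler p * rho ^+ k.+1) ^+ k <=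
      (1 + 25 / 73) * mahler_at rho (gpoly p k + 1) ^+ k.
  move=> rho_gt1 rho_lt4 growth_ge.
  have rhok_gt1 : 1 < rho ^+ k by rewrite exprn_egt1 // -lt0n.
  apply: mahler_at_gpoly1_bounds => //; [lra | lra |].
  exact: le_trans growth_ge (ler_gpoly_growth _ _ p_ge5 k_gt1).
apply: (@disk_roots_eq _ 1 s t (gpoly_mahler p) (1 + 25 / 73) _ k) => //.
- exact: ltW.
- by rewrite -(@ler_pXn2r _ k) ?nnegrE // sk tk; lra.
- exact: lt_le_trans (gpoly_mahler_ge1 p).
- lra.
- by rewrite sk tk; lra.
- by move=> z; apply: gpoly1_root_free_annulus => //; rewrite tk; lra.
- move=> rho; rewrite !inE => /pred2P[] ->; apply: bounds => //;
    rewrite ?sk ?tk /gpoly_growth /circle_lb; lra.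
Qed.

Lemma mahler_at_gpoly1 p k rho : (1 < k)%N -> 5 <= p -> 1 <= rho ->
  rho ^+ k <= p - 1 ->
  mahler_at rho (gpoly p k + 1) = mahler (gpoly p k + 1) * rho ^+ k.+1.
Proof.
move=> k_gt1 p_ge5 rho_ge1 rho_p; have k_gt0 := ltnW k_gt1.
rewrite (@mahler_at_annulus _ 1 rho) // => [|z].
  by rewrite disk_roots_gpoly1 // divr1.
by apply: gpoly1_root_free_annulus => //; exact: le_trans rho_ge1.
Qed.

Lemma mahler_gpoly1_bounds p k t e : (1 < k)%N -> 5 <= p ->
  1 < t -> t < p - 1 -> 0 < e -> 1 + e^-1 <= gpoly_growth p k t ->
  mahler (gpoly p k + 1) <= gpoly_mahler p * (1 + e / k%:R) /\
  gpoly_mahler p <= mahler (gpoly p k + 1) * (1 + e / k%:R).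
Proof.
move=> k_gt1 p_ge5 t_gt1 tp e_gt0 e_le; have k_gt0 := ltnW k_gt1.
have [rho rho_gt1 rhok] := exists_root_gt1 k_gt0 t_gt1.
have := @mahler_at_gpoly1_bounds p k rho e k_gt0 rho_gt1; rewrite rhok.
move=> /(_ tp e_gt0 e_le).
rewrite (mahler_at_gpoly1 k_gt1 p_ge5 (ltW rho_gt1)) ?rhok ?(ltW tp) //.
have rho_gt0 : 0 < (rho ^+ k.+1) ^+ k by rewrite !exprn_gt0 ?(lt_trans ltr01).
rewrite ![(_ * rho ^+ _) ^+ k]exprMn !mulrA !ler_pM2r // => -[upper lower].
have M_ge0 : 0 <= mahler (gpoly p k + 1) by exact: mahler_ge0.
have A_ge0 : 0 <= gpoly_mahler p by exact: le_trans ler01 (gpoly_mahler_ge1 p).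
by split; apply: ler_bernoulli => //; exact: ltW.
Qed.

Lemma mahler_ge_approx_factor P S T rho d :
  T != 0 -> 1 <= rho -> 0 <= d -> d < 1 ->
  (forall z, root P z -> 1 < normc z -> rho <= normc z) ->
  (forall x, normc x = rho -> P.[x] != 0) ->
  (forall x, normc x = rho ->
     normc (S.[x] * T.[x] - P.[x]) <= d * normc P.[x]) ->
  size T = (disk_roots 1 P).+1 ->
  normc S.[0] * normc (lead_coef T) <= (1 + d) * mahler P.
Proof.
move=> T_neq0 rho_ge1 d_ge0 d_lt1 annulus P_rho approx sizeT.
have rho_gt0 : 0 < rho by exact: lt_le_trans rho_ge1.
have ST_le : mahler_at rho (S * T) <= (1 + d) * mahler_at rho P.
  apply: ler_mahler_at => // [|x x_rho|x x_rho]; first by rewrite addr_ge0.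
    rewrite hornerM; apply/eqP => ST0; have := approx x x_rho.
    rewrite ST0 sub0r normcN leNgt => /negP; apply.
    by rewrite gtr_pMl ?normc_gt0 ?P_rho.
  rewrite hornerM -[S.[x] * T.[x]](subrK P.[x]) addrC.
  by apply: le_trans (le_normcD _ _) _; rewrite mulrDl mul1r lerD2l approx.
have rhon_gt0 : 0 < rho ^+ disk_roots 1 P by rewrite exprn_gt0.
rewrite -(ler_pM2r rhon_gt0) -mulrA -[leRHS]mulrA.
have -> : mahler P * rho ^+ disk_roots 1 P = mahler_at rho P.
  by rewrite (mahler_at_annulus ltr01 rho_ge1 annulus) divr1.
apply: le_trans ST_le; rewrite mahler_atM.
apply: ler_pM; rewrite ?mulr_ge0 ?normc_ge0 ?(ltW rhon_gt0) //.
  exact: normc_horner0_le_mahler_at.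
by have := lead_coef_le_mahler_at T_neq0 (ltW rho_gt0); rewrite sizeT.
Qed.

Lemma mahler_gpoly1_ge_factor p k S T rho d : (1 < k)%N -> 5 <= p ->
  1 <= rho -> rho ^+ k <= p - 1 -> 1 < rho * circle_lb p (rho ^+ k) ->
  0 <= d -> d < 1 ->
  (forall x, normc x = rho -> normc (S.[x] * T.[x] - (gpoly p k + 1).[x]) <=
     d * (rho * circle_lb p (rho ^+ k) - 1)) ->
  size T = k.+2 ->
  normc S.[0] * normc (lead_coef T) <= (1 + d) * mahler (gpoly p k + 1).
Proof.
move=> k_gt1 p_ge5 rho_ge1 rho_p lb_gt1 d_ge0 d_lt1 approx sizeT.
have k_gt0 := ltnW k_gt1.
have f_ge x : normc x = rho ->
    rho * circle_lb p (rho ^+ k) - 1 <= normc (gpoly p k + 1).[x].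
  move=> x_rho; rewrite hornerD hornerC; apply: le_trans (lerB_normcD _ _).
  by rewrite Normc.normc1 lerD2r -x_rho normc_gpoly_ge ?x_rho //; lra.
apply: (mahler_ge_approx_factor _ rho_ge1 d_ge0 d_lt1)
  => [|z|x x_rho|x x_rho|].
- by rewrite -size_poly_eq0 sizeT.
- by apply: gpoly1_root_free_annulus => //; exact: le_trans rho_ge1.
- by rewrite -normc_gt0 (lt_le_trans _ (f_ge x x_rho)) // subr_gt0.
- by apply: le_trans (approx x x_rho) _; rewrite ler_wpM2l // f_ge.
- by rewrite disk_roots_gpoly1.
Qed.

End GPolyMahler.

Section Fpoly.
Variable R : realType.
Implicit Types (p t rho d e u v a x y : R) (k : nat).

Local Notation complex_poly s := (map_poly (real_complex R) (Poly s)).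

Lemma mahler_fpoly_le k t e : (1 < k)%N ->
  1 < t -> t < k.*2.+1%:R - 1 -> 0 < e ->
  1 + e^-1 <= gpoly_growth k.*2.+1%:R k t ->
  mahler (fpoly R k.*2.+1) <= (1 + k.*2.+1%:R ^- 2) * (1 + e / k%:R).
Proof.
move=> k_gt1 t_gt1 tp e_gt0 e_le; rewrite fpolyE.
have p_ge5 : 5 <= k.*2.+1%:R :> R by rewrite ler_nat ltnS (leq_double 2).
have [upper _] := mahler_gpoly1_bounds k_gt1 p_ge5 t_gt1 tp e_gt0 e_le.
apply: le_trans upper _; rewrite ler_wpM2r ?gpoly_mahler_le //.
by rewrite addr_ge0 ?divr_ge0 ?(ltW e_gt0).
Qed.

Lemma mahler_fpoly3_ge : 7 / 6 <= mahler (fpoly R 3).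
Proof.
pose s : seq R := [:: 1; - 3^-1; 1; 3^-1].
have fE : fpoly R 3 = complex_poly s.
  rewrite map_Poly /fpoly; apply/polyP => i; rewrite !coefE.
  by case: i => [|[|[|[|i]]]] /=; rewrite ?nth_nil; field.
have PolyE : Poly s = s :> seq R by rewrite (@PolyK _ 0) //= invr_eq0 pnatr_eq0.
have [||x /andP[_ x_le] rx] := @poly_ivt R (Poly s) (- 4) (- (7 / 2)).
- lra.
- by rewrite !horner_Poly /=; lra.
have f_neq0 : fpoly R 3 != 0 by rewrite fE map_poly_eq0 -size_poly_eq0 PolyE.
have := root_le_mahler f_neq0 (z := x%:C); rewrite fE fmorph_root lead_coef_map.
move=> /(_ rx); rewrite !normc_real lead_coefE PolyE /= ger0_norm ?invr_ge0 //.
by rewrite ler0_norm; lra.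
Qed.

Lemma mahler_gpoly1_ge_real_factor p rho d k (s t r : seq R) :
  (1 < k)%N -> 5 <= p -> 1 <= rho -> rho ^+ k <= p - 1 ->
  1 < rho * circle_lb p (rho ^+ k) -> 0 <= d -> d < 1 ->
  (forall z, (complex_poly s).[z] * (complex_poly t).[z] =
     (gpoly p k + 1).[z] + (complex_poly r).[z]) ->
  (Poly [seq `|a| | a <- r]).[rho] <= d * (rho * circle_lb p (rho ^+ k) - 1) ->
  last 0 t != 0 -> size t = k.+2 ->
  `|(Poly s).[0]| * `|last 0 t| <= (1 + d) * mahler (gpoly p k + 1).
Proof.
move=> k_gt1 p_ge5 rho_ge1 rho_p lb_gt1 d_ge0 d_lt1 factor r_le last_t size_t.
have lead_t : lead_coef (complex_poly t) = (last 0 t)%:C.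
  by rewrite lead_coef_map lead_coefE (PolyK last_t) nth_last.
have := mahler_gpoly1_ge_factor k_gt1 p_ge5 rho_ge1 rho_p lb_gt1 d_ge0 d_lt1.
move=> /(_ (complex_poly s) (complex_poly t)); rewrite lead_t !normc_real.
have -> : (complex_poly s).[0] = (Poly s).[0]%:C.
  by rewrite -(rmorph0 (real_complex R)) horner_map.
rewrite normc_real size_map_poly (PolyK last_t); apply=> // z z_rho.
rewrite factor addrAC subrr add0r; apply: le_trans r_le.
have -> : [seq `|a| | a <- r] = [seq normc z | z <- [seq a%:C | a <- r]].
  by rewrite -map_comp; apply: eq_map => a; rewrite -normc_real.
by rewrite map_Poly -z_rho; exact: ler_normc_horner_Poly.
Qed.

(* In the next two proofs, s and t approximate the factors of [fpoly R p] with
   the roots outside and inside the unit disk, rounded to two (p = 5) or three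
   (p = 7) decimals. *)
Lemma mahler_fpoly5_ge : 207 / 200 <= mahler (fpoly R 5).
Proof.
pose s : seq R := [seq a / 100 | a <- [:: 525; 17; 100]].
pose t : seq R := [seq a / 5 / 100 | a <- [:: 95; -22; -17; 100]].
pose r : seq R := [seq a / 5 / 100 ^+ 2 | a <- [:: -125; 65; 201; 11]].
have factor z : (complex_poly s).[z] * (complex_poly t).[z] =
    (gpoly 5 2 + 1).[z] + (complex_poly r).[z].
  by rewrite hornerD hornerC horner_gpoly !map_Poly !horner_Poly /=; field.
suff : `|(Poly s).[0]| * `|last 0 t| <= (1 + 75^-1) * mahler (gpoly 5 2 + 1).
  by rewrite -(fpolyE R 2) horner_Poly /= !ger0_norm; lra.
apply: (mahler_gpoly1_ge_real_factor (rho := 3 / 2) _ _ _ _ _ _ _ factor) => //;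
  [lra | lra | | lra | lra | |].
- by rewrite /circle_lb; lra.
- rewrite /circle_lb horner_Poly /=.
  by rewrite !(normrM, normrN, normfV, normrX, normr_nat); lra.
- by apply: lt0r_neq0; rewrite /=; lra.
Qed.

Lemma mahler_fpoly7_ge : 203 / 200 <= mahler (fpoly R 7).
Proof.
pose s : seq R := [seq a / 1000 | a <- [:: 7152; 36; 134; 1000]].
pose t : seq R := [seq a / 7 / 1000 | a <- [:: 979; -145; -18; -134; 1000]].
pose r : seq R :=
  [seq a / 7 / 1000 ^+ 2 | a <- [:: 1808; -1796; -2770; 554; -236; 44]].
have factor z : (complex_poly s).[z] * (complex_poly t).[z] =
    (gpoly 7 3 + 1).[z] + (complex_poly r).[z].
  by rewrite hornerD hornerC horner_gpoly !map_Poly !horner_Poly /=; field.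
suff : `|(Poly s).[0]| * `|last 0 t| <= (1 + 300^-1) * mahler (gpoly 7 3 + 1).
  by rewrite -(fpolyE R 3) horner_Poly /= !ger0_norm; lra.
apply: (mahler_gpoly1_ge_real_factor (rho := 3 / 2) _ _ _ _ _ _ _ factor) => //;
  [lra | lra | lra | | lra | lra | |].
- by rewrite /circle_lb; lra.
- rewrite /circle_lb horner_Poly /=.
  by rewrite !(normrM, normrN, normfV, normrX, normr_nat); lra.
- by apply: lt0r_neq0; rewrite /=; lra.
Qed.

(* The growth at p / 2 is at least p^5 / 512; raising 512 to 520 makes room for
   the term 1. *)
Lemma gpoly_growth_half_ge p k : (3 < k)%N -> 9 <= p ->
  1 + (520 / p ^+ 5)^-1 <= gpoly_growth p k (p / 2).
Proof.
move=> k_gt3 p_ge9; have p_gt0 : 0 < p by lra.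
apply: le_trans (ler_gpoly_growth _ _ (lexx p) k_gt3); [|lra|lra].
have p5_ge : 9 ^+ 5 <= p ^+ 5 by rewrite lerXn2r ?nnegrE //; lra.
have lb_ge : p / 4 <= circle_lb p (p / 2).
  have -> : circle_lb p (p / 2) = p / 4 + p^-1.
    by rewrite /circle_lb; field; rewrite gt_eqF.
  by rewrite lerDl invr_ge0 ltW.
apply: (@le_trans _ _ (p / 2 * (p / 4) ^+ 4)); last first.
  by rewrite ler_pM2l ?divr_gt0 // lerXn2r ?nnegrE ?(le_trans _ lb_ge) //; lra.
by rewrite invf_div; lra.
Qed.

Lemma mahler_fpoly_large_bounds k (p : R := k.*2.+1%:R) : (3 < k)%N ->
  mahler (fpoly R k.*2.+1) <= (1 + p ^- 2) * (1 + 520 / p ^+ 5 / k%:R) /\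
  1 + p ^- 2 - p ^- 4 <= mahler (fpoly R k.*2.+1) * (1 + 520 / p ^+ 5 / k%:R).
Proof.
move=> k_gt3; have p_ge9 : 9 <= p by rewrite ler_nat ltnS (leq_double 4).
have k_gt1 : (1 < k)%N by exact: leq_trans k_gt3.
have e_gt0 : 0 < 520 / p ^+ 5 by rewrite divr_gt0 ?exprn_gt0 //; lra.
have t_gt1 : 1 < p / 2 by lra.
have tp : p / 2 < p - 1 by lra.
have p_ge5 : 5 <= p by lra.
have growth_ge := gpoly_growth_half_ge k_gt3 p_ge9.
have [_ lower] := mahler_gpoly1_bounds k_gt1 p_ge5 t_gt1 tp e_gt0 growth_ge.
split; first exact: mahler_fpoly_le growth_ge.
by rewrite fpolyE (le_trans (gpoly_mahler_ge p)).
Qed.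

(* With u = 1 / p and v = 1 / (p + 2), the terms 130 u^5 and 104 v^5 bound the
   errors 520 / p^5 / k for k >= 4 and 520 / (p + 2)^5 / (k + 1); the factor
   103 / 100 absorbs their products with other terms. *)
Lemma subr_sqr_gt_errors u v : 0 < u -> u <= 9^-1 -> u - v = 2 * (u * v) ->
  u ^+ 4 + 103 / 100 * (104 * v ^+ 5 + 130 * u ^+ 5) < u ^+ 2 - v ^+ 2.
Proof.
move=> u_gt0 u_le uv; have u_ge0 := ltW u_gt0.
have v_ge : 9 / 11 * u <= v by nra.
have v_ge0 : 0 <= v by lra.
have v_le : v <= u by nra.
have u2_le : u ^+ 2 <= 81^-1 by nra.
have v2_le : v ^+ 2 <= 81^-1 by nra.
have u4_le : u ^+ 4 <= u * (u ^+ 2 / 9).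
  by rewrite [u ^+ 4]exprS ler_pM2l // exprSr ler_wpM2l ?exprn_ge0.
have u5_le : u ^+ 5 <= u * (u ^+ 2 / 81).
  by rewrite exprS ler_pM2l // (exprD u 2 2) ler_wpM2l ?exprn_ge0.
have v5_le : v ^+ 5 <= u * (v ^+ 2 / 81).
  by rewrite exprS ler_pM ?exprn_ge0 // (exprD v 2 2) ler_wpM2l ?exprn_ge0.
have dominated : u ^+ 2 / 9 + 103 / 100 * (104 * v ^+ 2 + 130 * u ^+ 2) / 81 <
    2 * v * (u + v) by nra.
have -> : u ^+ 2 - v ^+ 2 = u * (2 * v * (u + v)) by rewrite subr_sqr uv; ring.
by move: dominated; rewrite -(ltr_pM2l u_gt0); lra.
Qed.

Lemma ler_prod_1D_small a x y : 0 <= a -> 0 <= x -> 0 <= y ->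
  a <= 81^-1 -> y <= 100^-1 ->
  (1 + a) * (1 + x) * (1 + y) <= 1 + a + 103 / 100 * (x + y).
Proof.
move=> a_ge0 x_ge0 y_ge0 a_le y_le.
have xy_le : (1 + x) * (1 + y) <= 1 + 101 / 100 * (x + y) by nra.
by rewrite -mulrA; nra.
Qed.

Lemma gpoly_mahler_bounds_lt p : 9 <= p ->
  (1 + (p + 2) ^- 2) * (1 + 104 / (p + 2) ^+ 5) * (1 + 130 / p ^+ 5) <
  1 + p ^- 2 - p ^- 4.
Proof.
move=> p_ge9; rewrite -!exprVn; set u := p^-1; set v := (p + 2)^-1.
have u_gt0 : 0 < u by rewrite invr_gt0; lra.
have v_gt0 : 0 < v by rewrite invr_gt0; lra.
have uv : u - v = 2 * (u * v) by rewrite /u /v; field; rewrite !gt_eqF //; lra.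
have u_le : u <= 9^-1 by rewrite lef_pV2 ?posrE //; lra.
have v_le : v <= 9^-1 by nra.
have u5_le : u ^+ 5 <= 9^-1 ^+ 5.
  by rewrite lerXn2r ?nnegrE ?(ltW u_gt0) ?invr_ge0.
have v2_le : v ^+ 2 <= 81^-1 by nra.
have decrease := subr_sqr_gt_errors u_gt0 u_le uv.
have x_ge0 : 0 <= 104 * v ^+ 5 by rewrite mulr_ge0 ?exprn_ge0 ?(ltW v_gt0).
have y_ge0 : 0 <= 130 * u ^+ 5 by rewrite mulr_ge0 ?exprn_ge0 ?(ltW u_gt0).
have y_le : 130 * u ^+ 5 <= 100^-1 by lra.
by have := ler_prod_1D_small (sqr_ge0 v) x_ge0 y_ge0 v2_le y_le; lra.
Qed.

Lemma mahler_fpoly_lt_large k : (3 < k)%N ->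
  mahler (fpoly R k.+1.*2.+1) < mahler (fpoly R k.*2.+1).
Proof.
move=> k_gt3; pose p : R := k.*2.+1%:R.
have p_ge9 : 9 <= p by rewrite ler_nat ltnS (leq_double 4).
have k_ge4 : 4 <= k%:R :> R by rewrite ler_nat.
have qE : k.+1.*2.+1%:R = p + 2 :> R by rewrite -natrD addn2.
have [upper _] := mahler_fpoly_large_bounds (leqW k_gt3).
have [_ lower] := mahler_fpoly_large_bounds k_gt3.
have p5V_gt0 : 0 < (p ^+ 5)^-1 by rewrite invr_gt0 exprn_gt0 //; lra.
have q5V_gt0 : 0 < ((p + 2) ^+ 5)^-1 by rewrite invr_gt0 exprn_gt0 //; lra.
have error_p : 520 / p ^+ 5 / k%:R <= 130 / p ^+ 5.
  rewrite ler_pdivrMr; last by lra.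
  by rewrite [leRHS]mulrAC ler_pM2r //; lra.
have error_q : 520 / (p + 2) ^+ 5 / k.+1%:R <= 104 / (p + 2) ^+ 5.
  rewrite -natr1 ler_pdivrMr; last by lra.
  by rewrite [leRHS]mulrAC ler_pM2r //; lra.
have factor_gt0 : 0 < 1 + 130 / p ^+ 5 by rewrite addr_gt0 ?mulr_gt0.
rewrite -(ltr_pM2r factor_gt0).
have {}upper : mahler (fpoly R k.+1.*2.+1) <=
    (1 + (p + 2) ^- 2) * (1 + 104 / (p + 2) ^+ 5).
  apply: le_trans upper _; rewrite qE.
  by rewrite ler_wpM2l ?lerD2l ?addr_ge0 ?invr_ge0 ?sqr_ge0.
have {}lower : 1 + p ^- 2 - p ^- 4 <=
    mahler (fpoly R k.*2.+1) * (1 + 130 / p ^+ 5).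
  by apply: le_trans lower _; rewrite ler_wpM2l ?lerD2l ?mahler_ge0.
apply: lt_le_trans lower; apply: le_lt_trans (gpoly_mahler_bounds_lt p_ge9).
by rewrite ler_pM2r.
Qed.

Lemma mahler_fpoly5_lt : mahler (fpoly R 5) < 7 / 6.
Proof.
apply: le_lt_trans (@mahler_fpoly_le 2 3 (41 / 200) isT _ _ _ _) _;
  rewrite /gpoly_growth /circle_lb -?[2.*2.+1]/5%N; lra.
Qed.

Lemma mahler_fpoly7_lt : mahler (fpoly R 7) < 207 / 200.
Proof.
apply: le_lt_trans (@mahler_fpoly_le 3 4 (41 / 1000) isT _ _ _ _) _;
  rewrite /gpoly_growth /circle_lb -?[3.*2.+1]/7%N; lra.
Qed.

Lemma mahler_fpoly9_lt : mahler (fpoly R 9) < 203 / 200.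
Proof.
apply: le_lt_trans (@mahler_fpoly_le 4 4 (9 / 1000) isT _ _ _ _) _;
  rewrite /gpoly_growth /circle_lb -?[4.*2.+1]/9%N; lra.
Qed.

End Fpoly.

Theorem theorem3 (R : realType) (p : nat) (hp : (3 <= p)%N) (hodd : odd p) :
  mahler (fpoly R (p + 2)) < mahler (fpoly R p).
Proof.
have pE : p = p./2.*2.+1 by rewrite -[LHS]odd_double_half hodd.
rewrite pE addn2 -doubleS; move: p./2 pE hp => k -> {p hodd}.
case: k => [|[|[|[|k]]]] // _; last exact: mahler_fpoly_lt_large.
- exact: lt_le_trans (mahler_fpoly5_lt R) (mahler_fpoly3_ge R).
- exact: lt_le_trans (mahler_fpoly7_lt R) (mahler_fpoly5_ge R).
- exact: lt_le_trans (mahler_fpoly9_lt R) (mahler_fpoly7_ge R).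
Qed.
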